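(* For each $t\in\{4,5\}$, all integers $k\ge 3$ and all integers $n\ge (2t-3)(k-1)+\lceil k/2\rceil\lceil k/2\rceil-1$, there exists a $(K_t,\mathcal{T}_k)$-co-critical graph $G$ on $n$ vertices such that $$e(G)\le\left(\frac{4t-9}{2}+\frac12\left\lceil\frac k2\right\rceil\right)n+C(t,k),$$ where $C(t,k)=\frac12(t^2+t-5)k^2-(2t^2+2t-11)k-\frac{(t-2)(t-19)}{2}-\frac12\left\lceil\frac k2\right\rceil\left((2t-3)(k-1)-\left\lceil\frac k2\right\rceil\right)$.
   Context: All graphs are finite and simple; $e(G)$ is the number of edges. $\mathcal{T}_k$ denotes the family of all trees on $k$ vertices. For a graph $G$ we write $G\to(K_t,\mathcal{T}_k)$ if every 2-coloring of $E(G)$ with colors red and blue contains a red $K_t$ or a blue copy of some tree in $\mathcal{T}_k$. A non-complete graph $G$ is $(K_t,\mathcal{T}_k)$-co-critical if $G\not\to(K_t,\mathcal{T}_k)$ but $G+e\to(K_t,\mathcal{T}_k)$ for every edge $e$ of the complement $\overline{G}$. *)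

(* Defs.v *)
From HB Require Import structures.
From mathcomp Require Import all_boot all_order all_algebra.

Set Implicit Arguments.
Unset Strict Implicit.
Unset Printing Implicit Defensive.

Record sgraph (V : finType) := SGraph {
  adj :> rel V;
  adj_sym : symmetric adj;
  adj_irr : irreflexive adj }.

Definition edges (V : finType) (G : sgraph V) : {set {set V}} :=
  [set A | [exists x, exists y, G x y && (A == [set x; y])]].

Definition is_complete (V : finType) (G : sgraph V) : Prop :=
  forall x y, x != y -> G x y.

Lemma complete_sym (V : finType) : symmetric [rel x y : V | x != y].
Proof. by move=> x y /=; rewrite eq_sym. Qed.

Lemma complete_irr (V : finType) : irreflexive [rel x y : V | x != y].
Proof. by move=> x /=; rewrite eqxx. Qed.

Definition K (t : nat) : sgraph 'I_t :=
  SGraph (@complete_sym 'I_t) (@complete_irr 'I_t).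

Definition is_connected (V : finType) (G : sgraph V) : Prop :=
  0 < #|V| /\ forall x y, connect G x y.

(* Cycles have length at least 3: in path.v a single edge is a closed path
   of length 2. *)
Definition is_acyclic (V : finType) (G : sgraph V) : Prop :=
  forall s : seq V, 2 < size s -> uniq s -> ~~ cycle G s.

Definition is_tree (V : finType) (G : sgraph V) : Prop :=
  is_connected G /\ is_acyclic G.

Section AddEdge.
Variables (V : finType) (G : sgraph V) (x y : V).

Definition add_edge_rel : rel V :=
  [rel a b | G a b || (a != b) && ([set a; b] == [set x; y])].

Lemma add_edge_sym : symmetric add_edge_rel.
Proof. by move=> a b ; rewrite /add_edge_rel /= adj_sym eq_sym setUC. Qed.

Lemma add_edge_irr : irreflexive add_edge_rel.
Proof. by move=> a ; rewrite /add_edge_rel /= adj_irr eqxx. Qed.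

Definition add_edge : sgraph V := SGraph add_edge_sym add_edge_irr.

End AddEdge.

(* Not necessarily induced. *)
Definition has_copy (W V : finType) (H : rel W) (G : rel V) : Prop :=
  exists2 f : W -> V, injective f & forall x y, H x y -> G (f x) (f y).

(* A 2-coloring of E(G) is given by a map c on unordered pairs, with
   true = red and false = blue; its values outside E(G) are irrelevant. *)
Definition red (V : finType) (G : sgraph V) (c : {set V} -> bool) : rel V :=
  [rel x y | G x y && c [set x; y]].

Definition blue (V : finType) (G : sgraph V) (c : {set V} -> bool) : rel V :=
  [rel x y | G x y && ~~ c [set x; y]].

(* G -> (K_t, T_k) *)
Definition arrows (V : finType) (G : sgraph V) (t k : nat) : Prop :=
  forall c : {set V} -> bool,
    has_copy (K t) (red G c) \/
    exists H : sgraph 'I_k, is_tree H /\ has_copy H (blue G c).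

Definition co_critical (V : finType) (G : sgraph V) (t k : nat) : Prop :=
  [/\ ~ is_complete G,
      ~ arrows G t k &
      forall x y, x != y -> ~~ G x y -> arrows (add_edge G x y) t k].

Local Open Scope ring_scope.

(* uphalf k is the ceiling of k / 2. *)
Definition Ctk (t k : nat) : rat :=
  let T : rat := t%:R in
  let k' : rat := k%:R in
  let h : rat := (uphalf k)%:R in
  1 / 2 * (T ^+ 2 + T - 5) * k' ^+ 2
  - (2 * T ^+ 2 + 2 * T - 11) * k'
  - (T - 2) * (T - 19) / 2
  - 1 / 2 * h * ((2 * T - 3) * (k' - 1) - h).

(* Main.v *)
Require Import Defs.
From mathcomp Require Import all_boot all_order all_algebra.
From mathcomp Require Import zify lra.

(** Coloring each vertex by its blue component shows that [G -> (K_t, T_k)] fails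
    iff the vertices have a good coloring: all classes have fewer than [k]
    elements and no [K_t] is rainbow.  So it suffices to build a graph with an
    essentially unique good coloring in which each non-edge would complete a
    rainbow [K_t].

    Put [a = t - 2] and [r = k - 1].  Start from a complete graph on [a + 1] parts
    of size [r], the hub.  A good coloring has exactly [a + 1] colors on it, all of
    them full, so every outside vertex gets another color.  The last part has no
    outside neighbor.  Outside the hub put disjoint cliques whose sizes add up
    pairwise to more than [r].  A "light" vertex sees only the first vertex [a_i]
    of each part [i < a], whereas a "heavy" one, in a clique of size [r], sees all
    these parts.  Two modifications: [y_i] is heavy but misses [a_i], and is joined
    to the light vertices that see only [a_i] in part [i]; [z_i] is light but sees
    all of the parts [j <> i], and is not joined to [y_j].

    A light vertex [x] and a vertex [v <> a_i] of part [i] thus have the common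
    neighbors [y_i] and [a_j] for [j <> i], so [xv] would complete a rainbow [K_t].
    As [y_i] and [z_i] are adjacent, with different colors, their common hub
    neighbors, namely all the parts [j <> i], span at most [a - 1] colors, which
    forces the coloring of the hub.  Light vertices have degree about [2 a], plus
    the size [uphalf k] of their cliques, which gives the linear term. *)

Set Implicit Arguments.
Unset Strict Implicit.
Unset Printing Implicit Defensive.

(** * Trees in connected graphs *)

Section ParentTree.
Variables (k : nat) (p : 'I_k.+1 -> 'I_k.+1).
Hypothesis parent_lt : forall i : 'I_k.+1, 0 < i -> p i < i.

Definition parent_rel : rel 'I_k.+1 :=
  [rel i j : 'I_k.+1 | (0 < j) && (i == p j) || (0 < i) && (j == p i)].

Lemma parent_sym : symmetric parent_rel.
Proof. by move=> i j; rewrite /parent_rel /= orbC. Qed.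

Lemma parent_irr : irreflexive parent_rel.
Proof.
move=> i; rewrite /parent_rel /= orbb; apply/negbTE/negP => /andP[i0 /eqP ip].
by have := parent_lt i0; rewrite -ip ltnn.
Qed.

Definition parent_graph : sgraph 'I_k.+1 := SGraph parent_sym parent_irr.

Lemma parent_rel_le (i j : 'I_k.+1) : parent_rel i j -> j <= i -> j = p i.
Proof.
move=> /orP[/andP[j0 /eqP->]|/andP[_ /eqP//]] le.
by have := leq_trans (parent_lt j0) le; rewrite ltnn.
Qed.

Lemma parent_graph_tree : is_tree parent_graph.
Proof.
split.
  split=> [|x y]; first by rewrite card_ord.
  have to0 m (i : 'I_k.+1) : i <= m -> connect parent_graph i ord0.
    elim: m i => [|m IHm] i.
      by rewrite leqn0 => /eqP i0; rewrite (_ : i = ord0) //; apply/val_inj.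
    move=> le; have [i0|i0] := posnP i.
      by rewrite (_ : i = ord0) //; apply/val_inj.
    apply: (connect_trans (y := p i)).
      by apply: connect1; rewrite /= /parent_rel /= i0 eqxx orbT.
    by apply: IHm; rewrite -ltnS (leq_trans (parent_lt i0)).
  apply: (connect_trans (to0 _ _ (leqnn x))).
  by rewrite (sym_connect_sym (@adj_sym _ parent_graph)) (to0 _ _ (leqnn y)).
move=> s s2 us; apply/negP => cs.
(* Both neighbours, along the cycle, of its largest vertex are its parent. *)
case: s s2 us cs => // x0 s s2 us cs.
have [j js jmax] : exists2 j, j \in x0 :: s & forall i, i \in x0 :: s -> i <= j.
  have x0s : x0 \in x0 :: s by rewrite mem_head.
  by case: (arg_maxnP (fun i : 'I_k.+1 => i : nat) x0s) => j ? ?; exists j.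
have [n s' rs] := rot_to js.
have us' : uniq (j :: s') by rewrite -rs rot_uniq.
have cs' : cycle parent_graph (j :: s') by rewrite -rs rot_cycle.
have ms' i : i \in j :: s' -> i <= j by rewrite -rs mem_rot; apply: jmax.
have ss' : 1 < size s' by rewrite -ltnS -[(size s').+1]/(size (j :: s')) -rs size_rot.
case: s' ss' us' cs' ms' {rs} => // x [//|y s'] _ us' cs' ms'.
move: cs'; rewrite /= rcons_path => /and3P[jx _ /andP[_ lj]].
have xp : x = p j by apply: parent_rel_le jx (ms' _ _); rewrite !inE eqxx orbT.
have lp : last y s' = p j.
  apply: parent_rel_le; first by rewrite parent_sym.
  by apply: ms'; rewrite 2!in_cons mem_last !orbT.
move: us' => /= /and3P[_ + _].
by rewrite xp -lp mem_last.
Qed.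

End ParentTree.

(** As long as the list is smaller than the component of [v], some edge leaves it, and the outer end
    of that edge is appended. *)
Lemma connected_growth (V : finType) (e : rel V) (v : V) (k : nat) :
    k < #|connect e v| ->
  exists s : seq V, [/\ size s = k.+1, uniq s, v \in s &
    forall i, 0 < i <= k -> exists2 j, j < i & e (nth v s j) (nth v s i)].
Proof.
elim: k => [|k IHk] kv.
  by exists [:: v]; split=> // [|i]; rewrite ?mem_head //; case: i.
have [s [ss us vs es]] := IHk (ltnW kv).
have /exists_inP[x xs /exists_inP[y ys exy]] :
    [exists x in s, exists y in [predC s], e x y].
  apply: contraLR kv => none; rewrite -leqNgt -ss.
  apply: leq_trans (card_size s); apply/subset_leq_card/subsetP => u.
  rewrite -topredE /= => /connectP[w]; elim: w v {es IHk} vs => [|w q IHq] x xs /=.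
    by move=> _ ->.
  case/andP=> exw; apply: IHq; apply: contraNT none => ws.
  by apply/exists_inP; exists x => //; apply/exists_inP; exists w.
exists (rcons s y); split.
- by rewrite size_rcons ss.
- by rewrite rcons_uniq us andbT.
- by rewrite mem_rcons inE vs orbT.
move=> i /andP[i0]; rewrite leq_eqVlt => /orP[/eqP-> | ik].
  exists (index x s); first by rewrite -ss index_mem.
  by rewrite !nth_rcons -{1}ss index_mem xs ss ltnn eqxx nth_index.
have [|j ji ej] := es i; first by rewrite i0.
by exists j => //; rewrite !nth_rcons ss ik (ltn_trans ji ik).
Qed.

Lemma tree_in_component (V : finType) (e : rel V) (v : V) (k : nat) :
    symmetric e -> k < #|connect e v| ->
  exists H : sgraph 'I_k.+1, is_tree H /\ has_copy H e.
Proof.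
move=> se /connected_growth[s [ss us vs es]].
pose f (i : 'I_k.+1) := nth v s i.
(* The default [ord0] occurs only at the root [i = 0]; every later index has an earlier neighbor. *)
pose p (i : 'I_k.+1) := odflt ord0 [pick j : 'I_k.+1 | (j < i) && e (f j) (f i)].
have pP (i : 'I_k.+1) : 0 < i -> (p i < i) && e (f (p i)) (f i).
  move=> i0; rewrite /p; case: pickP => // none.
  have [|j ji ej] := es i; first by rewrite i0 -ltnS /=.
  by have := none (Ordinal (ltn_trans ji (ltn_ord i))); rewrite /f /= ji ej.
have plt (i : 'I_k.+1) : 0 < i -> p i < i by case/pP/andP.
exists (parent_graph plt); split; first exact: parent_graph_tree.
exists f => [i j /eqP | i j].
  by rewrite nth_uniq ?ss // => /eqP/val_inj.
move=> /orP[] /andP[/pP/andP[_ ep] /eqP->] //.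
by rewrite se.
Qed.

(** * Good colorings *)

Definition rainbow (V : finType) (C : eqType) (G : rel V) (f : V -> C)
    (A : {set V}) : Prop :=
  {in A &, forall x y, x != y -> G x y && (f x != f y)}.

(** Edges inside a class are thought of as blue and all others as red: blue components stay within
    classes, and rainbow cliques are the red ones. *)
Definition good_coloring (V : finType) (C : eqType) (G : rel V) (t k : nat)
    (f : V -> C) : Prop :=
  (forall v, #|[set u | f u == f v]| < k) /\
  (forall A : {set V}, rainbow G f A -> #|A| < t).

Lemma good_coloring_not_arrows (V : finType) (C : eqType) (G : sgraph V)
    (t k : nat) (f : V -> C) :
  good_coloring G t k f -> ~ arrows G t k.
Proof.
move=> [small norain] arr.
pose c (A : {set V}) := [exists x in A, exists y in A, f x != f y].
have cE x y : c [set x; y] = (f x != f y).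
  apply/exists_inP/idP => [[u ux /exists_inP[w wx]]|xy].
    move: ux wx; rewrite !inE => /orP[]/eqP-> /orP[]/eqP->; rewrite ?eqxx //.
    by rewrite eq_sym.
  exists x; rewrite ?set21 //; apply/exists_inP; exists y; rewrite ?set22 //.
have [[g ginj gK]|[H [[[H0 Hc] _] [g ginj gH]]]] := arr c.
  have : #|g @: setT| < t.
    apply: norain => _ _ /imsetP[i _ ->] /imsetP[j _ ->]; rewrite (inj_eq ginj) => ij.
    by have := gK i j ij; rewrite /red /= cE.
  by rewrite card_imset // cardsT card_ord ltnn.
have /card_gt0P[i0 _] := H0.
have fg i : f (g i) = f (g i0).
  have /connectP[q] := Hc i i0; elim: q i => [|j q IHq] i /= => [_ -> // | /andP[ij jq] lq].
  by rewrite -(IHq j) //; apply/eqP; have := gH i j ij; rewrite /blue /= cE negbK => /andP[].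
have := small (g i0); apply/negP; rewrite -leqNgt.
rewrite -{1}(card_ord k) -cardsT -(card_imset _ ginj); apply/subset_leq_card/subsetP.
by move=> _ /imsetP[i _ ->]; rewrite inE fg.
Qed.

(** If all blue components have at most [k] vertices, sending each vertex to the root of its
    component gives small classes. As this coloring is not good, it has a rainbow clique of size at
    least [t], whose edges join different components and so are red. *)
Lemma arrows_of_no_good_coloring (V : finType) (G : sgraph V) (t k : nat) :
    (forall f : V -> V, ~ good_coloring G t k.+1 f) -> arrows G t k.+1.
Proof.
move=> bad c.
have bsym : symmetric (blue G c) by move=> x y; rewrite /blue /= adj_sym setUC.
have [/existsP[v big]|none] := boolP [exists v, k < #|connect (blue G c) v|].
  by right; apply: tree_in_component big.
left; have rootE : forall x y,
    (fingraph.root (blue G c) x == fingraph.root (blue G c) y) = connect (blue G c) x y.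
  exact: fingraph.root_connect (sym_connect_sym bsym).
have /existsP[A /andP[/forall_inP rA tA]] :
    [exists A : {set V}, [forall x in A, forall y in A, (x != y) ==>
      G x y && (fingraph.root (blue G c) x != fingraph.root (blue G c) y)] && (t <= #|A|)].
  apply: contraT => /existsPn noA; case: (bad (fingraph.root (blue G c))); split.
    move=> v; move/existsPn: none => /(_ v); rewrite -leqNgt ltnS; apply: leq_trans.
    by apply/subset_leq_card/subsetP => u; rewrite inE eq_sym rootE.
  move=> A rA; rewrite ltnNge; apply/negP => tA.
  have /negP[] := noA A; rewrite tA andbT.
  by apply/forall_inP => x xA; apply/forall_inP => y yA; apply/implyP; apply: rA.
pose g (i : 'I_t) := enum_val (widen_ord tA i).
have ginj : injective g.
  by move=> i j /enum_val_inj e; apply: val_inj; exact: (congr1 val e).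
exists g; first exact: ginj.
move=> i j ij; have xy : g i != g j by rewrite (inj_eq ginj); exact: ij.
have /forall_inP/(_ _ (enum_valP (widen_ord tA j))) := rA _ (enum_valP (widen_ord tA i)).
rewrite -/(g i) -/(g j) xy /= rootE /red /= => /andP[Gxy].
by rewrite Gxy /=; apply: contraNT => cxy; apply: connect1; rewrite /blue /= Gxy.
Qed.

(** A good coloring of [G] plus [xy] is also good for [G], so it separates whatever [f0] separates.
    Then [x], [y] and [A] form a rainbow clique on [a + 2] vertices, a contradiction. *)
Lemma co_critical_of_coloring (V : finType) (C : eqType) (G : sgraph V)
    (a k : nat) (f0 : V -> C) :
    good_coloring G a.+2 k.+1 f0 ->
    (forall f : V -> V, good_coloring G a.+2 k.+1 f ->
      forall x y, f0 x != f0 y -> f x != f y) ->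
    (forall x y, x != y -> ~~ G x y -> exists A : {set V},
      [/\ f0 x != f0 y, #|A| = a, rainbow G f0 A & {in A, forall v,
        [&& G x v, G y v, f0 x != f0 v & f0 y != f0 v]}]) ->
    (exists x y, x != y /\ ~~ G x y) ->
  co_critical G a.+2 k.+1.
Proof.
move=> good0 uniq0 sat [x0 [y0 [xy0 nG]]]; split.
- by move=> /(_ _ _ xy0); apply/negP.
- exact: good_coloring_not_arrows good0.
move=> x y xy nxy; apply: arrows_of_no_good_coloring => f [small norain].
have good : good_coloring G a.+2 k.+1 f.
  split=> // A rA; apply: norain => u v uA vA uv.
  by have /andP[Guv ->] := rA u v uA vA uv; rewrite /= /add_edge_rel /= Guv.
have lift0 := uniq0 f good.
have [A [fxy cA rA aA]] := sat x y xy nxy.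
have xA : x \notin A by apply/negP => /aA; rewrite adj_irr.
have yA : y \notin A by apply/negP => /aA; rewrite [G y y]adj_irr andbF.
have : #|x |: (y |: A)| < a.+2.
  apply: norain => u v; rewrite !inE /= /add_edge_rel /=.
  have GxA w : w \in A -> (G x w || (x != w) && ([set x; w] == [set x; y])) && (f x != f w).
    by move=> /aA/and4P[-> _ fw _]; rewrite lift0.
  have GyA w : w \in A -> (G y w || (y != w) && ([set y; w] == [set x; y])) && (f y != f w).
    by move=> /aA/and4P[_ -> _ fw]; rewrite lift0.
  have sw p q : ((G p q || (p != q) && ([set p; q] == [set x; y])) && (f p != f q)) =
                ((G q p || (q != p) && ([set q; p] == [set x; y])) && (f q != f p)).
    by rewrite adj_sym eq_sym setUC [f p == _]eq_sym.
  case/or3P=> [/eqP->|/eqP->|uA] /or3P[/eqP->|/eqP->|vA] uv; rewrite ?eqxx // in uv *.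
  - by rewrite uv lift0 // orbT.
  - exact: GxA.
  - by rewrite sw eqxx eq_sym uv lift0 // orbT.
  - exact: GyA.
  - by rewrite sw GxA.
  - by rewrite sw GyA.
  - by have /andP[-> /lift0->] := rA u v uA vA uv.
by rewrite !cardsU1 !inE negb_or xy xA yA cA ltnn.
Qed.

(** * Transport along isomorphisms *)

Lemma arrows_iso (V V' : finType) (G : sgraph V) (G' : sgraph V') (g : V -> V')
    (t k : nat) :
    injective g -> (forall x y, G x y = G' (g x) (g y)) ->
  arrows G t k -> arrows G' t k.
Proof.
move=> ginj gG arr c.
have im2 x y : [set g x; g y] = g @: [set x; y] by rewrite imsetU1 imset_set1.
have [[f finj fK]|[H [tH [f finj fH]]]] := arr (fun A => c (g @: A)).
  left; exists (g \o f) => [|i j /fK]; first exact: inj_comp.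
  by rewrite /red /= gG im2.
right; exists H; split=> //; exists (g \o f) => [|i j /fH]; first exact: inj_comp.
by rewrite /blue /= gG im2.
Qed.

Lemma co_critical_iso (V V' : finType) (G : sgraph V) (G' : sgraph V')
    (g : V -> V') (g' : V' -> V) (t k : nat) :
    cancel g g' -> cancel g' g -> (forall x y, G x y = G' (g x) (g y)) ->
  co_critical G t k -> co_critical G' t k.
Proof.
move=> gK g'K gG [nc na cr].
have ginj := can_inj gK; have g'inj := can_inj g'K.
have g'G x y : G' x y = G (g' x) (g' y) by rewrite gG !g'K.
split.
- by move=> comp; apply: nc => x y xy; rewrite gG comp // (inj_eq ginj).
- by move=> arr; apply: na; apply: arrows_iso arr; first exact: g'inj.
move=> x y xy nxy.
have : arrows (add_edge G (g' x) (g' y)) t k by apply: cr; rewrite ?(inj_eq g'inj) -?g'G.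
apply: (arrows_iso ginj) => u v /=.
rewrite /add_edge_rel /= gG (inj_eq ginj); congr (_ || _ && _).
have im2 p q : [set g p; g q] = g @: [set p; q] by rewrite imsetU1 imset_set1.
by rewrite -(inj_eq (imset_inj ginj)) -!im2 !g'K.
Qed.

(** * Color classes of bounded size *)

Section ColorClasses.
Variables (V C : finType) (f : V -> C) (r : nat).
Hypothesis class_le : forall v, #|[set u | f u == f v]| <= r.

Lemma card_le_colors (A : {set V}) : #|A| <= #|f @: A| * r.
Proof.
rewrite -sum1_card (partition_big_imset f) /= -sum_nat_const.
apply: leq_sum => _ /imsetP[x xA ->]; apply: leq_trans (class_le x).
by rewrite sum1_card; apply/subset_leq_card/subsetP => u; rewrite !inE => /andP[].
Qed.

(** Adding [y] to [A] would add a vertex but no color, exceeding [r] vertices per color. *)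
Lemma full_classes_closed (A : {set V}) x y :
  #|f @: A| * r <= #|A| -> x \in A -> f y = f x -> y \in A.
Proof.
move=> full xA yx; apply: contraLR full => yA; rewrite -ltnNge.
have := card_le_colors (y |: A); rewrite cardsU1 yA add1n.
by rewrite imsetU1 yx (setUidPr _) // sub1set imset_f.
Qed.

Lemma color_representatives (A : {set V}) :
  exists B : {set V}, [/\ B \subset A, #|B| = #|f @: A| & {in B &, injective f}].
Proof.
pose B := [set x in A | [pick y in A | f y == f x] == Some x].
have Binj : {in B &, injective f}.
  move=> x y; rewrite !inE => /andP[_ /eqP px] /andP[_ /eqP py] fxy.
  by move: px; rewrite fxy py => -[].
have BA : B \subset A by apply/subsetP => x; rewrite inE => /andP[].
exists B; split=> //; rewrite -(card_in_imset Binj); apply: eq_card => d.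
apply/imsetP/imsetP => [[x xB ->]|[x xA ->]]; first by exists x; rewrite ?(subsetP BA).
case: (pickP (fun y => (y \in A) && (f y == f x))) => [y /andP[yA /eqP yx]|/(_ x)]; last first.
  by rewrite xA eqxx.
have [z zP] : exists z, [pick y in A | f y == f x] = Some z.
  by case: pickP => [z _|/(_ x)]; [exists z | rewrite xA eqxx].
have /andP[zA /eqP zx] : (z \in A) && (f z == f x).
  by move: zP; case: pickP => // z' ? [<-].
by exists z; rewrite // inE zA zx zP eqxx.
Qed.

End ColorClasses.

(** Representatives of the colors on the clique [A] extend [B] to a rainbow clique. *)
Lemma good_coloring_colors (V : finType) (G : sgraph V) (t k : nat) (f : V -> V)
    (A B : {set V}) :
    good_coloring G t k f -> rainbow G f B ->
    {in A &, forall x y, x != y -> G x y} ->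
    {in B & A, forall x y, G x y && (f x != f y)} ->
  #|B| + #|f @: A| < t.
Proof.
move=> [_ norain] rB clA BA; have [A' [A'A <- A'inj]] := color_representatives f A.
have dis : [disjoint B & A'].
  apply/pred0P => x /=; apply/negP => /andP[xB /(subsetP A'A) xA].
  by have := BA x x xB xA; rewrite adj_irr.
rewrite -cardsUI (disjoint_setI0 dis) cards0 addn0; apply: norain => x y.
rewrite !inE => /orP[xB|xA'] /orP[yB|yA'] xy; first exact: rB.
- exact: BA (subsetP A'A _ yA').
- by rewrite adj_sym eq_sym BA // (subsetP A'A).
- rewrite clA ?(subsetP A'A) //=; apply: contraNN xy => /eqP/A'inj ->//.
Qed.

(** * The hub graph and its unique good coloring *)

Section Construction.
Variables (a r0 : nat) (W C : finType) (c : W -> C).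
Variables (mis onl : 'I_a -> W -> bool) (heavy : pred W) (y z : 'I_a -> W).
Let r := r0.+2.

(* [None] is the part without outside neighbors. *)
Definition hub := (option 'I_a * 'I_r)%type.

(* [mis i w]: [w] is not joined to the first vertex of part [i]; [onl i w]: [w] is
   joined to no other vertex of part [i]. *)
Definition attached (q : hub) (w : W) : bool :=
  if q.1 is Some i then
    if q.2 == 0 :> nat then ~~ mis i w else ~~ onl i w
  else false.

(* Vertices of different cliques are joined iff, in some part, they have no common
   neighbor. *)
Definition linked (u w : W) : bool :=
  (u != w) &&
  ((c u == c w) || [exists i, mis i u && onl i w || onl i u && mis i w]).

Definition hub_rel : rel (hub + W) := fun x y =>
  match x, y with
  | inl p, inl q => p != q
  | inl q, inr w => attached q w
  | inr w, inl q => attached q w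
  | inr u, inr w => linked u w
  end.

Lemma linked_sym : symmetric linked.
Proof.
move=> u w; rewrite /linked eq_sym [c u == _]eq_sym; congr (_ && (_ || _)).
by apply: eq_existsb => i; rewrite orbC ![mis i _ && _]andbC.
Qed.

Lemma hub_sym : symmetric hub_rel.
Proof. by case=> [p|u] [q|w] //=; [rewrite eq_sym | rewrite linked_sym]. Qed.

Lemma hub_irr : irreflexive hub_rel.
Proof. by case=> [p|u]; rewrite /= ?/linked eqxx. Qed.

Definition hub_graph : sgraph (hub + W)%type := SGraph hub_sym hub_irr.

Definition hub_coloring (x : hub + W) : option 'I_a + C :=
  match x with inl q => inl q.1 | inr w => inr (c w) end.

Definition fiber (w : W) := [set u | c u == c w].

Hypothesis a_ge2 : 1 < a.
Hypothesis fiber_le : forall w, #|fiber w| <= r.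
Hypothesis fibers_gt : forall u w, c u != c w -> r < #|fiber u| + #|fiber w|.
Hypothesis heavyE : forall u w, c u = c w -> heavy u = heavy w.
Hypothesis mis_heavy : forall i w, mis i w -> heavy w.
Hypothesis onl_light : forall i w, onl i w -> ~~ heavy w.
Hypothesis misy : forall i j, mis j (y i) = (j == i).
Hypothesis fibery : forall i, #|fiber (y i)| = r.
Hypothesis onlz : forall i j, onl j (z i) = (j == i).
Hypothesis heavy_mis : forall u w, heavy u -> c u = c w ->
  #|[set i | mis i u || mis i w]| < r.

Let heavyy i : heavy (y i). Proof. by apply: (@mis_heavy i); rewrite misy. Qed.
Let lightz i : ~~ heavy (z i). Proof. by apply: (@onl_light i); rewrite onlz. Qed.

(** [mis] holds only for heavy vertices and [onl] only for light ones. Links between different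
    cliques are therefore bipartite, and a rainbow clique has at most two outside vertices. *)
Lemma linked_heavy u w :
  linked u w -> c u != c w -> exists2 i, mis i u && onl i w || onl i u && mis i w
    & heavy u = ~~ heavy w.
Proof.
move=> /andP[_ /orP[->//|/existsP[i uw]]] _; exists i => //.
case/orP: uw => /andP[].
  by move=> /mis_heavy-> /onl_light->.
by move=> /onl_light/negbTE-> /mis_heavy->.
Qed.

(** The hub has [a + 1] colors. One outside vertex in a rainbow clique excludes the part [None]; two
    of them also exclude the part [i] in which they have no common neighbor. *)
Lemma hub_coloring_good : good_coloring hub_graph a.+2 r.+1 hub_coloring.
Proof.
split=> [[[j l]|w]|A rA].
- rewrite ltnS; apply: (@leq_trans #|[set (inl (j, l') : hub + W) | l' : 'I_r]|).
    apply/subset_leq_card/subsetP => -[[j' l']|w']; rewrite inE => /eqP //= [->].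
    exact: imset_f.
  by rewrite (leq_trans (leq_imset_card _ _)) // card_ord.
- rewrite ltnS; apply: leq_trans (fiber_le w).
  rewrite -(card_imset (mem (fiber w)) (@inr_inj hub W)).
  apply/subset_leq_card/subsetP => -[q|w']; rewrite inE => /eqP //= [cw].
  by apply: imset_f; rewrite inE cw.
have cinj : {in A &, injective hub_coloring}.
  move=> u v uA vA e; apply/eqP/idPn => uv.
  by have := rA u v uA vA uv; rewrite e eqxx andbF.
rewrite -(card_in_imset cinj) ltnS.
have Alink u w : inr u \in A -> inr w \in A -> u != w -> linked u w && (c u != c w).
  by move=> uA wA uw; apply: (rA (inr u) (inr w)).
have Aatt u q : inr u \in A -> inl q \in A -> attached q u.
  by move=> uA qA; have /andP[] := rA (inl q) (inr u) qA uA isT.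
have [/existsP[u uA]|noW] := boolP [exists u, inr u \in A]; last first.
  apply: (@leq_trans #|[set (inl j : option 'I_a + C) | j : option 'I_a]|).
    apply/subset_leq_card/subsetP => _ /imsetP[[q|w] qA ->] /=; first exact: imset_f.
    by case/negP: noW; apply/existsP; exists w.
  by rewrite (leq_trans (leq_imset_card _ _)) // card_option card_ord.
have [/existsP[w /andP[wA uw]]|noW] := boolP [exists w, (inr w \in A) && (u != w)].
  have /andP[luw cuw] := Alink u w uA wA uw.
  have [i iuw huw] := linked_heavy luw cuw.
  apply: (@leq_trans #|inr (c u) |: (inr (c w) |: [set (inl (Some j) : option 'I_a + C) | j in [set~ i]])|).
    apply/subset_leq_card/subsetP => _ /imsetP[[q|v] qA ->] /=; rewrite !inE.
      have := Aatt u q uA qA; have := Aatt w q wA qA; rewrite /attached.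
      case: q qA => -[j|] l //= qA attw attu.
      apply/imsetP; exists j => //; rewrite !inE; apply/eqP => ji; subst j.
      move: iuw attw attu; case: ifP => _; last by case: (onl i u); case: (onl i w); rewrite /= ?andbF.
      by case: (mis i u); case: (mis i w); rewrite /= ?andbF.
    have [->|uv] := eqVneq u v; first by rewrite eqxx.
    have [->|wv] := eqVneq w v; first by rewrite eqxx orbT.
    have /andP[luv cuv] := Alink u v uA qA uv; have /andP[lwv cwv] := Alink w v wA qA wv.
    have [_ _ huv] := linked_heavy luv cuv; have [_ _ hwv] := linked_heavy lwv cwv.
    by move: huw; rewrite huv hwv; case: (heavy v).
  rewrite !cardsU1; apply: (@leq_trans (1 + (1 + a.-1))); last by case: (a) a_ge2.
  apply: leq_add; first exact: leq_b1.
  apply: leq_add; first exact: leq_b1.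
  by rewrite (leq_trans (leq_imset_card _ _)) // cardsC1 card_ord.
apply: (@leq_trans #|inr (c u) |: [set (inl (Some j) : option 'I_a + C) | j : 'I_a]|).
  apply/subset_leq_card/subsetP => _ /imsetP[[q|v] qA ->] /=; rewrite !inE.
    have := Aatt u q uA qA; rewrite /attached; case: q qA => -[j|] l //= _ _.
    by apply: imset_f.
  have [->|uv] := eqVneq u v; first by rewrite eqxx.
  by case/negP: noW; apply/existsP; exists v; rewrite qA.
rewrite cardsU1 (leq_add (leq_b1 _)) //.
by rewrite (leq_trans (leq_imset_card _ _)) // card_ord.
Qed.

Let lt_aE m : (m < a) = (m <= a.-1).
Proof. by rewrite -[RHS]ltnS prednK // ltnW. Qed.

Let transversal (D : {set 'I_a}) (l : 'I_a -> 'I_r) : {set hub + W} :=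
  [set inl (Some i, l i) | i in D].

Lemma card_transversal D l : #|transversal D l| = #|D|.
Proof. by rewrite card_imset // => i j []. Qed.

Lemma transversal_rainbow D l : rainbow hub_graph hub_coloring (transversal D l).
Proof.
move=> _ _ /imsetP[i _ ->] /imsetP[j _ ->] /= ij.
by rewrite ij /=; apply: contraNN ij => /eqP[->].
Qed.

(** * Every good coloring separates the parts and the cliques *)

Section Uniqueness.
Variable f : hub + W -> hub + W.
Hypothesis f_good : good_coloring hub_graph a.+2 r.+1 f.

Let class_le v : #|[set u | f u == f v]| <= r.
Proof. by rewrite -ltnS; case: f_good => /(_ v). Qed.

Let inl_clique (A : {set hub}) :
  {in @inl hub W @: A &, forall u v, u != v -> hub_graph u v}.
Proof. by move=> _ _ /imsetP[p _ ->] /imsetP[q _ ->]. Qed.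

(** The hub is a clique on [(a + 1) * r] vertices with at most [a + 1] colors, so its color classes
    are full and leave no room for [inr w]. *)
Lemma hub_outside_colors q w : f (inl q) != f (inr w).
Proof.
apply/eqP => qw; pose A := @inl hub W @: setT.
have : inr w \in A.
  apply: (full_classes_closed class_le (x := inl q)) => //; last by rewrite /A imset_f.
  rewrite [X in _ <= X](card_imset _ (@inl_inj hub W)) cardsT.
  rewrite card_prod card_option !card_ord leq_mul2r.
  have := good_coloring_colors (A := A) (B := set0) f_good _ _ _.
  rewrite cards0 add0n ltnS => -> //.
  - by move=> x; rewrite inE.
  - exact: inl_clique.
  - by move=> x; rewrite inE.
by case/imsetP.
Qed.

(** The vertices [u] and [w], with one vertex per color of [A], form a rainbow clique, because hub
    and outside colors never coincide. *)
Lemma common_hub_colors u w (A : {set hub}) :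
    linked u w -> f (inr u) != f (inr w) ->
    {in A, forall q, attached q u && attached q w} ->
  #|f @: (@inl hub W @: A)| < a.
Proof.
move=> uw fuw Auw; have uw' : u != w by case/andP: uw.
have := good_coloring_colors (A := inl @: A) (B := [set inr u; inr w]) f_good.
rewrite cards2 (inj_eq (@inr_inj hub W)) uw' /= => lt; rewrite -2!ltnS; apply: lt.
- move=> x v; rewrite !inE => /orP[]/eqP-> /orP[]/eqP->; rewrite ?eqxx //= => _.
    by rewrite uw.
  by rewrite linked_sym uw eq_sym.
- exact: inl_clique.
move=> x v; rewrite !inE => xuw /imsetP[q /Auw /andP[qu qw] ->].
by case/orP: xuw => /eqP -> /=; rewrite eq_sym hub_outside_colors ?qu ?qw.
Qed.

Lemma common_hub_card u w (A : {set hub}) :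
    linked u w -> f (inr u) != f (inr w) ->
    {in A, forall q, attached q u && attached q w} ->
  #|A| <= a.-1 * r.
Proof.
move=> uw fuw Auw; have := common_hub_colors uw fuw Auw.
rewrite lt_aE => lt.
rewrite -(card_imset (mem A) (@inl_inj hub W)).
by apply: leq_trans (card_le_colors class_le _) _; rewrite leq_mul2r lt orbT.
Qed.

Lemma common_transversal u w (l : 'I_a -> 'I_r) :
    linked u w -> (forall i, attached (Some i, l i) u && attached (Some i, l i) w) ->
    (forall i j, i != j -> f (inl (Some i, l i)) != f (inl (Some j, l j))) ->
  f (inr u) = f (inr w).
Proof.
move=> uw luw lf; apply/eqP/idPn => fuw.
have : #|f @: (@inl hub W @: [set (Some i, l i) | i : 'I_a])| < a.
  by apply: common_hub_colors uw fuw _ => _ /imsetP[i _ ->].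
rewrite -2!imset_comp card_imset ?card_ord ?ltnn // => i j /= /eqP.
by apply: contraTeq => /lf.
Qed.

Let setS := [set ((Some p.1, p.2) : hub) | p : 'I_a * 'I_r].

Let card_setS : #|setS| = a * r.
Proof. by rewrite card_imset ?card_prod ?card_ord // => -[i l] [j m] [-> ->]. Qed.

(** Differently colored [u] and [w] would have at most [(a - 1) * r] common hub neighbors, but they
    share the [a * r] vertices of the parts [Some i] except for fewer than [r] first vertices, those
    missed by one of them. *)
Lemma heavy_mono u w : heavy u -> c u = c w -> f (inr u) = f (inr w).
Proof.
move=> hu cuw; apply/eqP/idPn => fuw.
have uw : linked u w.
  by rewrite /linked cuw eqxx andbT; apply: contraNneq fuw => ->.
have hw : heavy w by rewrite -(heavyE cuw).
have lightN i v : heavy v -> ~~ onl i v by apply: contraTN => /onl_light.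
pose bad := [set ((Some i, ord0) : hub) | i in [set i | mis i u || mis i w]].
have badS : #|setS :\: bad| <= a.-1 * r.
  apply: common_hub_card uw fuw _ => _ /setDP[/imsetP[[i l] _ ->] /= nbad].
  rewrite /attached /= !lightN //; case: ifP => // /eqP l0.
  rewrite -negb_or; apply: contraNN nbad => m.
  by apply/imsetP; exists i; rewrite ?inE //; congr (_, _); apply/val_inj.
have := leq_trans (leq_imset_card (fun i => (Some i, ord0) : hub) _) (ltnW (heavy_mis hu cuw)).
have := heavy_mis hu cuw.
have := leq_imset_card (fun i => (Some i, ord0) : hub) [set i | mis i u || mis i w].
have := subset_leq_card (subsetIr setS bad); rewrite -/bad.
move: badS; rewrite cardsD card_setS.
have : a * r = a.-1 * r + r by rewrite -mulSnr prednK // ltnW.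
lia.
Qed.

(** The clique of [y i] is monochromatic with [r] vertices, so it already fills its color class. *)
Lemma heavy_class_closed i w : f (inr w) = f (inr (y i)) -> c w = c (y i).
Proof.
move=> fw.
have : inr w \in @inr hub W @: fiber (y i).
  apply: (full_classes_closed class_le (x := inr (y i))) => //; last first.
    by rewrite imset_f // inE.
  rewrite (card_imset _ (@inr_inj hub W)) fibery.
  rewrite -imset_comp (_ : _ @: _ = [set f (inr (y i))]) ?cards1 ?mul1n //.
  apply/setP => v; rewrite inE; apply/imsetP/eqP => [[u]|->]; last first.
    by exists (y i); rewrite ?inE.
  by rewrite inE => /eqP cu -> /=; apply/esym/heavy_mono => //; apply: heavyy.
by case/imsetP => u; rewrite inE => /eqP <- [->].
Qed.

Lemma linkedyz i : linked (y i) (z i).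
Proof.
apply/andP; split.
  by apply/eqP => e; have := lightz i; rewrite -e heavyy.
by apply/orP; right; apply/existsP; exists i; rewrite misy onlz eqxx.
Qed.

Lemma cyz i j : c (y i) != c (z j).
Proof.
by apply/eqP => /heavyE; rewrite heavyy => e; have := lightz j; rewrite -e.
Qed.

(* The common hub neighbours of [y i] and [z i], namely all the vertices of the
   parts [Some j] with [j != i], exactly fill the [a - 1] color classes that
   they can have. *)
Lemma hub_minus_part_closed i j (l : 'I_r) (q : hub) :
  j != i -> f (inl (Some j, l)) = f (inl q) -> exists2 j', j' != i & q.1 = Some j'.
Proof.
move=> ji fq; pose A := [set ((Some p.1, p.2) : hub) | p in setX [set~ i] [set: 'I_r]].
have cA : #|A| = a.-1 * r.
  rewrite card_imset; last by move=> [i1 l1] [i2 l2] [-> ->].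
  by rewrite cardsX cardsC1 cardsT !card_ord.
have fyz : f (inr (y i)) != f (inr (z i)).
  apply/eqP => e; have := heavy_class_closed (esym e).
  by move=> /esym/eqP; apply/negP/cyz.
have := common_hub_colors (A := A) (linkedyz i) fyz.
have Aatt : {in A, forall p, attached p (y i) && attached p (z i)}.
  move=> _ /imsetP[[j' l'] /setXP[/= j'i _] ->]; rewrite !inE in j'i.
  rewrite /attached /= misy onlz (negbTE j'i) /=.
  have -> : ~~ onl j' (y i) by apply: (contraTN (@onl_light j' (y i))); apply: heavyy.
  have -> : ~~ mis j' (z i) by apply: (contraNN (@mis_heavy j' (z i))); apply: lightz.
  by case: ifP.
move=> /(_ Aatt) lt.
have : inl q \in @inl hub W @: A.
  apply: (full_classes_closed class_le (x := inl (Some j, l))) => //.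
    rewrite (card_imset (mem A) (@inl_inj hub W)) cA leq_mul2r.
    by rewrite -lt_aE lt orbT.
  apply: imset_f; apply/imsetP; exists (j, l) => //.
  by rewrite !inE ji.
move=> /imsetP[q' /imsetP[[j' l'] /setXP[/= j'i _] ->] [->]].
by exists j' => //; rewrite !inE in j'i.
Qed.

Lemma hub_separated (p q : hub) : p.1 != q.1 -> f (inl p) != f (inl q).
Proof.
wlog [i pi] : p q / exists i, p.1 = Some i.
  case: p q => [[i|] l] [[j|] m] //= H pq; first by apply: H => //; exists i.
    by apply: H => //; exists i.
  by rewrite eq_sym; apply: H => //; exists j.
case: p pi => _ l /= ->; case: q => [[j|] m] /= ij; apply/eqP.
  move=> e; have ij' : i != j by apply: contraNneq ij => ->.
  by have [j' /eqP + [e']] := hub_minus_part_closed ij' e; rewrite -e'.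
(* Since [a] is at least 2, some other index [j] exists; the parts other than [Some j] and [None]
   form a union of classes containing the first vertex but not the second. *)
have [j ji] : exists j : 'I_a, i != j.
  have : 0 < #|[set~ i]| by rewrite cardsC1 card_ord; case: (a) a_ge2 => [|[]].
  by case/card_gt0P => j; rewrite !inE eq_sym; exists j.
by move=> e; have [] := hub_minus_part_closed ji e.
Qed.

(** Light vertices of one clique share the first vertices of all the parts [Some i]. These have [a]
    colors by [hub_separated], more than differently colored adjacent vertices can share. *)
Lemma outside_mono u w : c u = c w -> f (inr u) = f (inr w).
Proof.
move=> cuw; have [hu|lu] := boolP (heavy u); first exact: heavy_mono.
have [->//|uw] := eqVneq u w.
have lw : ~~ heavy w by rewrite -(heavyE cuw).
apply: (@common_transversal u w (fun=> ord0)).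
- by rewrite /linked uw cuw eqxx.
- by move=> i; rewrite /attached /= !(contraNN (@mis_heavy i _)).
by move=> i j ij; apply: hub_separated => /=; apply: contraNneq ij => -[->].
Qed.

(** Both cliques are monochromatic and together have more than [r] vertices. *)
Lemma outside_separated u w : c u != c w -> f (inr u) != f (inr w).
Proof.
move=> cuw; apply/eqP => fuw; have := fibers_gt cuw; rewrite ltnNge => /negP; apply.
apply: leq_trans (class_le (inr u)).
have dis : [disjoint fiber u & fiber w].
  by apply/pred0P => v /=; apply/negP; rewrite !inE => /andP[/eqP->]; apply/negP.
rewrite -cardsUI (disjoint_setI0 dis) cards0 addn0.
rewrite -(card_imset _ (@inr_inj hub W)); apply/subset_leq_card/subsetP.
move=> _ /imsetP[v vuw ->]; rewrite inE.
by case/setUP: vuw; rewrite inE => /eqP/outside_mono->; rewrite ?fuw.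
Qed.

Lemma hub_coloring_unique u v : hub_coloring u != hub_coloring v -> f u != f v.
Proof.
case: u v => [p|u] [q|w] /= ne.
- by apply: hub_separated; apply: contraNneq ne => ->.
- exact: hub_outside_colors.
- by rewrite eq_sym hub_outside_colors.
- by apply: outside_separated; apply: contraNneq ne => ->.
Qed.

End Uniqueness.

(** * Non-edges complete rainbow cliques *)

Definition completes (u v : hub + W) (A : {set hub + W}) : Prop :=
  [/\ hub_coloring u != hub_coloring v, #|A| = a,
      rainbow hub_graph hub_coloring A &
      {in A, forall x, [&& hub_graph u x, hub_graph v x,
        hub_coloring u != hub_coloring x & hub_coloring v != hub_coloring x]}].

Lemma completes_sym u v A : completes u v A -> completes v u A.
Proof.
by move=> [uv cA rA uvA]; split; rewrite 1?eq_sym // => x /uvA/and4P[-> -> -> ->].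
Qed.

Let ord1 : 'I_r := @Ordinal r 1 isT.

(** [b] marks the parts whose first vertex has to be avoided; the second one serves there. *)
Let base (b : 'I_a -> bool) (i : 'I_a) : 'I_r := if b i then ord1 else ord0.

Lemma attached_base (b : 'I_a -> bool) i w :
  (mis i w -> b i) -> (b i -> ~~ onl i w) -> attached (Some i, base b i) w.
Proof. by rewrite /attached /base /=; case: (b i) => //= m o; [exact: o | apply/negP => /m]. Qed.

Let mis_onlN i j w : mis i w -> ~~ onl j w.
Proof. by move=> /mis_heavy hw; apply: contraTN hw; apply: onl_light. Qed.

Lemma completes_transversal u w (b : 'I_a -> bool) (x : hub + W) :
    (forall i, attached (Some i, base b i) w) ->
    (forall i, hub_graph x (inl (Some i, base b i))) ->
    (forall i, hub_coloring x != inl (Some i)) -> hub_coloring x != inr (c w) ->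
    u = x ->
  completes u (inr w) (transversal setT (base b)).
Proof.
move=> attw adjx colx cxw ->; split=> //.
- by rewrite card_transversal cardsT card_ord.
- exact: transversal_rainbow.
by move=> _ /imsetP[i _ ->]; rewrite adjx /= attw colx.
Qed.

(** Vertices of part [i] have the color of the hub endpoint and are excluded, so the outside vertex
    [v] takes the place of one. *)
Lemma completes_swap i l w v (b : 'I_a -> bool) :
    linked v w -> c v != c w -> attached (Some i, l) v ->
    (forall j, j != i -> attached (Some j, base b j) v) ->
    (forall j, j != i -> attached (Some j, base b j) w) ->
  completes (inl (Some i, l)) (inr w) (inr v |: transversal [set~ i] (base b)).
Proof.
move=> vw cvw iv attv attw; split=> //.
- rewrite cardsU1 card_transversal cardsC1 card_ord.
  have -> : inr v \notin transversal [set~ i] (base b) by apply/imsetP => -[].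
  by rewrite add1n prednK // ltnW.
- have vt x : x \in transversal [set~ i] (base b) ->
      hub_graph (inr v) x && (hub_coloring (inr v) != hub_coloring x).
    by move=> /imsetP[j]; rewrite !inE => ji -> /=; rewrite attv.
  move=> x1 x2; rewrite !inE => /orP[/eqP->|x1t] /orP[/eqP->|x2t] x12.
  + by rewrite eqxx in x12.
  + exact: vt.
  + by rewrite adj_sym eq_sym vt.
  + exact: (transversal_rainbow x1t x2t).
move=> x; rewrite !inE => /orP[/eqP->|/imsetP[j]].
  by rewrite /= iv linked_sym vw /=; apply: contraNneq cvw => -[->].
rewrite !inE => ji -> /=; rewrite attw //= andbT.
by apply/andP; split; apply: contraNneq ji => -[->].
Qed.

Lemma hub_graph_saturated u v :
  u != v -> ~~ hub_graph u v -> exists A, completes u v A.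
Proof.
have qw q w : ~~ attached q w -> exists A, completes (inl q) (inr w) A.
  case: q => -[i|] l natt; last first.
    exists (transversal setT (base (mis^~ w))); apply: completes_transversal (erefl _) => //= i.
    by apply: attached_base => // /mis_onlN.
  (* If [w] misses the first vertex, it is heavy and the light [z i] is the extra common neighbor;
     if it misses a later one, it is light and the heavy [y i] is. *)
  have [l0|l0] := eqVneq (l : nat) 0.
    have mw : mis i w by move: natt; rewrite /attached /= l0 negbK.
    exists (inr (z i) |: transversal [set~ i] (base (mis^~ w))); apply: completes_swap.
    - rewrite /linked; apply/andP; split.
        by apply/eqP => e; have := lightz i; rewrite e (mis_heavy mw).
      by apply/orP; right; apply/existsP; exists i; rewrite onlz eqxx mw orbT.
    - by apply/eqP => /heavyE e; have := lightz i; rewrite e (mis_heavy mw).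
    - by rewrite /attached /= l0; apply: contraNN (lightz i); apply: mis_heavy.
    - move=> j ji; apply: attached_base => [m|_]; last by rewrite onlz.
      by have := lightz i; rewrite (mis_heavy m).
    - by move=> j _; apply: attached_base => // /mis_onlN.
  have ow : onl i w by move: natt; rewrite /attached /= (negbTE l0) negbK.
  exists (inr (y i) |: transversal [set~ i] (base (fun=> false))); apply: completes_swap.
  - rewrite /linked; apply/andP; split.
      by apply/eqP => e; have := onl_light ow; rewrite -e heavyy.
    by apply/orP; right; apply/existsP; exists i; rewrite misy eqxx ow.
  - by apply/eqP => /heavyE e; have := onl_light ow; rewrite -e heavyy.
  - rewrite /attached /= (negbTE l0); apply: (contraTN (@onl_light i (y i))).
    exact: heavyy.
  - by move=> j ji; apply: attached_base => //; rewrite misy (negbTE ji).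
  - move=> j ji; apply: attached_base => // /mis_heavy hw.
    by have := onl_light ow; rewrite hw.
case: u v => [p|u] [q|w] uv nuv.
- by move: nuv; rewrite /= -[p == q](inj_eq (@inl_inj hub W)) uv.
- exact: qw.
- by have [A /completes_sym ?] := qw q u nuv; exists A.
have uw : u != w by apply: contraNneq uv => ->.
move: nuv; rewrite /= /linked uw negb_or => /andP[cuw /existsPn nuw].
(* In a part where [u] or [w] misses the first vertex, neither is restricted to it, as they are not
   linked; the second vertex is then common. *)
pose b i := mis i u || mis i w.
have bo i v : v \in [:: u; w] -> b i -> ~~ onl i v.
  have := nuw i; rewrite negb_or !inE /b => /andP[nu nw] /orP[]/eqP-> /orP[] m.
  - exact: mis_onlN m.
  - by move: nw; rewrite m andbT.
  - by move: nu; rewrite m.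
  - exact: mis_onlN m.
exists (transversal setT (base b)); apply: completes_transversal (erefl _) => /= [i|i|i|].
- by apply: attached_base; [rewrite /b => ->; rewrite orbT | apply: bo; rewrite !inE eqxx orbT].
- by apply: attached_base; [rewrite /b => -> | apply: bo; rewrite !inE eqxx].
- by [].
by apply: contraNneq cuw => -[->].
Qed.

Theorem hub_graph_co_critical : co_critical hub_graph a.+2 r.+1.
Proof.
apply: co_critical_of_coloring hub_coloring_good _ hub_graph_saturated _.
  exact: hub_coloring_unique.
by exists (inl (None, ord0)), (inr (y (Ordinal (ltnW a_ge2)))).
Qed.

End Construction.

(** * Counting edges *)

Lemma double_edges_le (V : finType) (G : sgraph V) :
  #|edges G| * 2 <= \sum_x \sum_y G x y.
Proof.
pose P := [set p : V * V | G p.1 p.2]; pose h (p : V * V) := [set p.1; p.2].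
have -> : \sum_x \sum_y G x y = #|P|.
  rewrite pair_bigA -sum1_card [RHS]big_mkcond; apply: eq_bigr => p _.
  by rewrite inE; case: (G _ _).
have -> : edges G = h @: P.
  apply/setP => A; rewrite inE; apply/existsP/imsetP.
    by move=> [x /existsP[y /andP[xy /eqP ->]]]; exists (x, y); rewrite ?inE.
  move=> [[x y]]; rewrite inE => xy ->; exists x; apply/existsP; exists y.
  by rewrite xy eqxx.
rewrite -[#|P|]sum1_card (partition_big_imset h) /= -sum_nat_const.
apply: leq_sum => _ /imsetP[[x y] xyP ->]; rewrite inE /= in xyP.
have xy : (x, y) != (y, x) by apply: contraTneq xyP => -[->]; rewrite adj_irr.
have := cards2 (x, y) (y, x); rewrite xy /= sum1_card => <-.
apply/subset_leq_card/subsetP => p; rewrite !inE.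
  move=> /orP[]/eqP->; rewrite -topredE /= inE /=; first by rewrite xyP eqxx.
by rewrite adj_sym xyP /h /= setUC eqxx.
Qed.

Lemma sum_neq (T : finType) : \sum_(x : T) \sum_(y : T) (x != y) + #|T| = #|T| * #|T|.
Proof.
rewrite -[X in _ + X]sum1_card -big_split -sum_nat_const /=; apply: eq_bigr => x _.
rewrite (bigD1 x) //= eqxx add0n -[RHS]sum1_card [RHS](bigD1 x) //= addnC; congr (_ + _).
by apply: eq_bigr => y; rewrite eq_sym => ->.
Qed.

Lemma sum_option (T : finType) (F : option T -> nat) :
  \sum_x F x = F None + \sum_x F (Some x).
Proof.
rewrite (bigD1 None) //=; congr (_ + _); rewrite (reindex_omap Some id) /=.
  by apply: eq_bigl => x; rewrite eqxx.
by case.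
Qed.

Section EdgeCount.
Variables (a r0 : nat) (W C : finType) (c : W -> C).
Variables (mis onl : 'I_a -> W -> bool).
Let r := r0.+2.
Let N := a.+1 * r.
Let O := \sum_(i < a) \sum_w onl i w.
Hypothesis mis1 : forall i, \sum_w mis i w = 1.

(** Out of [a * r] possible hub neighbors per outside vertex, [mis] costs [a] edges in all, and each
    pair counted by [O] costs [r - 1]. *)
Lemma sum_attached :
  \sum_(q : hub a r0) \sum_w attached mis onl q w + a + r.-1 * O = a * r * #|W|.
Proof.
rewrite exchange_big /=.
have part w : \sum_(q : hub a r0) attached mis onl q w =
    \sum_(i < a) (~~ mis i w + r.-1 * ~~ onl i w).
  rewrite -(pair_bigA _ (fun j l => attached mis onl (j, l) w : nat)) /=.
  rewrite sum_option /= big1 // add0n; apply: eq_bigr => i _.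
  rewrite big_ord_recl /= /attached /=; congr (_ + _).
  by rewrite sum_nat_const card_ord.
rewrite (eq_bigr _ (fun w _ => part w)) exchange_big /= /O big_distrr /=.
have sum_const m : a * m = \sum_(i < a) m by rewrite sum_nat_const card_ord.
rewrite -[X in _ + X + _]muln1 -mulnA !sum_const -!big_split /=.
apply: eq_bigr => i _.
rewrite -[in _ + 1](mis1 i) big_split /= -big_distrr /= -addnA addnACA -mulnDr.
have compl (b : W -> bool) : \sum_w ~~ b w + \sum_w b w = #|W|.
  by rewrite -big_split -sum1_card /=; apply: eq_bigr => w _; case: (b w).
by rewrite !compl -mulSn.
Qed.

(** As [mis i] holds for a single vertex, at most [2 * O] ordered pairs are linked across cliques;
    the term [#|W|] is the diagonal. *)
Lemma sum_linked :
  \sum_u \sum_w linked c mis onl u w + #|W| <= \sum_u \sum_w (c u == c w) + O * 2.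
Proof.
have sO : \sum_u \sum_w \sum_(i < a) mis i u * onl i w = O.
  under eq_bigr do rewrite exchange_big /=.
  rewrite exchange_big; apply: eq_bigr => i _; rewrite exchange_big /=.
  by apply: eq_bigr => w _; rewrite -big_distrl /= mis1 mul1n.
have sO' : \sum_u \sum_w \sum_(i < a) mis i w * onl i u = O by rewrite exchange_big.
rewrite muln2 -addnn -{1}sO -sO' addnA -[#|W|]sum1_card -!big_split /=.
apply: leq_sum => u _; have -> : 1 = \sum_w (w == u).
  by rewrite (bigD1 u) //= eqxx big1 // => w /negbTE->.
rewrite -!big_split /=; apply: leq_sum => w _.
rewrite /linked eq_sym; have [->|wu] /= := eqVneq w u; first by rewrite eqxx.
rewrite addn0; case: eqP => //= _; case: existsP => // -[i iuw].
rewrite add0n (bigD1 i) //= [X in _ + X](bigD1 i) //=.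
by case/orP: iuw => /andP[-> ->] //; rewrite addnCA.
Qed.

Lemma hub_graph_edges_le :
  #|edges (hub_graph r0 c mis onl)| * 2 + N + #|W| + 2 * a + 2 * r * O <=
  N * N + 2 * (a * r * #|W|) + \sum_u \sum_w (c u == c w) + 4 * O.
Proof.
have := double_edges_le (hub_graph r0 c mis onl).
have -> : \sum_x \sum_y hub_graph r0 c mis onl x y =
    \sum_(p : hub a r0) \sum_(q : hub a r0) (p != q) +
    (\sum_(q : hub a r0) \sum_w attached mis onl q w) * 2 +
    \sum_u \sum_w linked c mis onl u w.
  rewrite big_sumType /=.
  under eq_bigr do rewrite big_sumType /=.
  under [X in _ + X]eq_bigr do rewrite big_sumType /=.
  by rewrite !big_split /= [X in _ + (X + _)]exchange_big /= muln2 -addnn !addnA.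
have QQ : \sum_(p : hub a r0) \sum_(q : hub a r0) (p != q) + N = N * N.
  have := sum_neq (hub a r0); rewrite !card_prod card_option !card_ord; exact.
have := sum_attached; have := sum_linked; have := QQ.
have -> : r.-1 * O = r * O - O by rewrite [r * O]mulSn addKn.
have : O <= r * O by rewrite leq_pmull.
rewrite -(mulnA 2 r); move: (r * O) (N * N) (a * r * #|W|) => x1 x2 x3.
lia.
Qed.

End EdgeCount.

(** * The graph with explicit blocks *)

Lemma card_set_sum (T : finType) (P : pred T) : #|[set x | P x]| = \sum_x P x.
Proof.
by rewrite -sum1_card big_mkcond; apply: eq_bigr => x _; rewrite inE; case: (P x).
Qed.

Lemma sum_eq_fst (T U : finType) (b : T) : \sum_(p : T * U) (p.1 == b) = #|U|.
Proof.
rewrite -(pair_bigA _ (fun i (_ : U) => (i == b) : nat)) /= (bigD1 b) //= eqxx.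
rewrite sum1_card big1 ?addn0 // => i /negbTE->.
by rewrite big1.
Qed.

Section Blocks.
Variables (a r0 d q h s : nat).
Let r := r0.+2.
Let light := ('I_q * 'I_h + 'I_s)%type.
Let outside := ('I_d * 'I_r + light)%type.
Variables (y : 'I_a -> 'I_d * 'I_r) (z : 'I_a -> light).

(** There are [d] heavy cliques of size [r], [q] light ones of size [h], and a last light one,
    [None], whose size [s] absorbs the remainder. *)
Definition block (w : outside) : 'I_d + option 'I_q :=
  match w with
  | inl p => inl p.1
  | inr (inl p) => inr (Some p.1)
  | inr (inr _) => inr None
  end.

Definition is_heavy (w : outside) : bool := if w is inl _ then true else false.

Definition misses i (w : outside) : bool := w == inl (y i).

(* [z j] lies in [only j] alone, every other light vertex in all the [only i]. *)
Definition only i (w : outside) : bool :=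
  if w is inr x then [forall j, (x == z j) ==> (j == i)] else false.

Lemma card_block w : #|fiber block w| =
  match w with inl _ => r | inr (inl _) => h | inr (inr _) => s end.
Proof.
rewrite card_set_sum !big_sumType /=.
case: w => [p|[p|x]] /=; rewrite !sum_nat_const !muln0 ?muln1 ?addn0 ?add0n.
- exact: etrans (sum_eq_fst _ _) (card_ord r).
- exact: etrans (sum_eq_fst _ _) (card_ord h).
exact: card_ord.
Qed.

Lemma sum_card_blocks :
  \sum_u \sum_w (block u == block w) = d * r * r + (q * h * h + s * s).
Proof.
under eq_bigr => u _.
  under eq_bigr do rewrite eq_sym.
  rewrite -card_set_sum -/(fiber block u) card_block; over.
by rewrite !big_sumType /= !sum_nat_const !card_prod !card_ord.
Qed.

Hypotheses (yinj : injective y) (zinj : injective z).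

Lemma sum_misses i : \sum_w misses i w = 1.
Proof.
by rewrite (bigD1 (inl (y i))) //= /misses eqxx big1 // => w /negbTE->.
Qed.

Lemma sum_only : a * (q * h + s) <= \sum_(i < a) \sum_w only i w + a * a.-1.
Proof.
have part i : q * h + s <= \sum_w only i w + a.-1.
  rewrite big_sumType /= big1 // add0n -card_set_sum.
  set A := [set x | _].
  have : #|~: A| <= #|[set z j | j in [set~ i]]|.
    apply/subset_leq_card/subsetP => x; rewrite !inE => /forallPn[j].
    by rewrite negb_imply => /andP[/eqP-> ji]; apply: imset_f; rewrite !inE.
  have := cardsC A; rewrite card_sum card_prod !card_ord => <-.
  by rewrite card_imset // cardsC1 card_ord leq_add2l.
have sum_const m : a * m = \sum_(i < a) m by rewrite sum_nat_const card_ord.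
by rewrite !sum_const -big_split leq_sum.
Qed.

Lemma blocks_edges_le N L W :
    N = a.+1 * r -> L = q * h + s -> W = d * r + L ->
  #|edges (hub_graph r0 block misses only)| * 2 + N + W + 2 * a + 2 * r * (a * L) <=
  N * N + 2 * (a * r * W) + (d * r * r + (q * h * h + s * s)) + 4 * (a * L)
  + 2 * r0 * (a * a.-1).
Proof.
move=> ND LD WD; have := hub_graph_edges_le r0 block only sum_misses.
rewrite sum_card_blocks !card_sum !card_prod !card_ord -/r -ND -LD -WD.
have := sum_only; rewrite -LD; set O := \sum_(i < a) _ => leO.
have := leq_mul (leqnn r0) leO; rewrite mulnDr.
(* The net coefficient of [O] on the left is [2 * r - 4 = 2 * r0], which is nonnegative, so the
   lower bound on [O] may be inserted. *)
have rE x : 2 * r * x = 2 * (r0 * x) + 4 * x by rewrite /r; lia.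
rewrite !rE -(mulnA 2 r0).
move: (r0 * O) (r0 * (a * L)) (r0 * (a * a.-1)) (N * N) (a * r * W) (d * r * r) => ? ? ? ? ? ?.
lia.
Qed.

Hypotheses (a_ge2 : 1 < a) (h_le : h <= r) (s_le : s <= r).
Hypotheses (r_hh : r < h + h) (r_hs : r < h + s).
Hypothesis y_blocks : forall i j, i != j -> (y i).1 = (y j).1 -> 2 < r.

Lemma blocks_co_critical :
  co_critical (hub_graph r0 block misses only) a.+2 r.+1.
Proof.
apply: (@hub_graph_co_critical a r0 outside _ block misses only is_heavy
  (fun i => inl (y i)) (fun i => inr (z i))) => //.
- by case=> [p|[p|x]]; rewrite card_block.
- move=> u w; rewrite !card_block.
  case: u => [p|[p|x]]; case: w => [p'|[p'|x']] //= ne.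
  + by rewrite -addn1 leq_add2l.
  + by rewrite -addn1 leq_add2l (leq_trans _ (ltn_ord p'.2)).
  + by rewrite -addn1 leq_add2l (leq_trans _ (ltn_ord x')).
  + by rewrite addnC -addn1 leq_add2l (leq_trans _ (ltn_ord p.2)).
  + by rewrite addnC -addn1 leq_add2l (leq_trans _ (ltn_ord x)).
  + by rewrite addnC.
- by case=> [p|[p|x]] [p'|[p'|x']].
- by move=> i w /eqP->.
- by move=> i [].
- by move=> i j; rewrite /misses (inj_eq inl_inj) (inj_eq yinj) eq_sym.
- by move=> i; rewrite card_block.
- move=> i j /=; apply/forallP/eqP => [/(_ i)|-> k]; first by rewrite eqxx => /eqP.
  by apply/implyP => /eqP/zinj->.
move=> u w _ cuw.
have one v : #|[set i | misses i v]| <= 1.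
  apply/card_le1_eqP => i j; rewrite !inE => /eqP-> /eqP[e].
  exact: yinj.
(* Two vertices miss at most two first vertices, fewer than [r] if [r > 2]; for [r = 2] a block
   contains at most one [y i]. *)
have [gt2|le2] := ltnP 2 r.
  apply: leq_ltn_trans gt2; rewrite (_ : [set _ | _] = [set i | misses i u] :|: [set i | misses i w]).
    by rewrite (leq_trans (leq_card_setU _ _)) // (leq_add (one u) (one w)).
  by apply/setP => i; rewrite !inE.
apply: (@leq_ltn_trans 1) => //; apply/card_le1_eqP => i j; rewrite !inE => mi mj.
apply/eqP/idPn => ij; have bi k v : misses k v -> block v = inl (y k).1 by move=> /eqP->.
suff e : (y i).1 = (y j).1 by have := y_blocks ij (esym e); rewrite ltnNge le2.
suff : block u = inl (y i).1 /\ block u = inl (y j).1 by case=> -> [].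
by split; [case/orP: mi => /bi; rewrite ?cuw | case/orP: mj => /bi; rewrite ?cuw].
Qed.

Lemma blocks_on_ordinals n : n = a.+1 * r + (d * r + (q * h + s)) ->
  exists G : sgraph 'I_n, co_critical G a.+2 r.+1 /\
    #|edges G| <= #|edges (hub_graph r0 block misses only)|.
Proof.
move=> n_def; set G0 := hub_graph _ _ _ _.
have cV : #|{: hub a r0 + outside}| = n.
  by rewrite !card_sum !card_prod card_option !card_ord.
pose g (i : 'I_n) : hub a r0 + outside := enum_val (cast_ord (esym cV) i).
pose g' x : 'I_n := cast_ord cV (enum_rank x).
have gK : cancel g g' by move=> i; rewrite /g /g' enum_valK cast_ordKV.
have g'K : cancel g' g by move=> x; rewrite /g /g' cast_ordK enum_rankK.
pose e := [rel i j | G0 (g i) (g j)].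
have es : symmetric e by move=> i j; apply: (adj_sym G0).
have ei : irreflexive e by move=> i; apply: (adj_irr G0).
exists (SGraph es ei); split.
  apply: (co_critical_iso g'K gK) blocks_co_critical => u v.
  by rewrite /= !g'K.
rewrite -(card_imset _ (imset_inj (can_inj gK))); apply/subset_leq_card/subsetP.
move=> _ /imsetP[A + ->]; rewrite !inE => /existsP[i /existsP[j /andP[ij /eqP->]]].
apply/existsP; exists (g i); apply/existsP; exists (g j).
by rewrite imsetU1 imset_set1 eqxx andbT.
Qed.

End Blocks.

(** * Choice of the sizes and the final estimate *)

Lemma exists_co_critical (a r0 d q h s n : nat) (r := r0.+2) (L := q * h + s) :
    1 < a -> h <= r -> s <= r -> r < h + h -> r < h + s ->
    (d = 1 /\ a <= r /\ 2 < r) \/ d = a -> a <= L ->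
    n = a.+1 * r + (d * r + L) ->
  exists G : sgraph 'I_n, co_critical G a.+2 r.+1 /\
    #|edges G| * 2 + n + 2 * a + 2 * r * (a * L) <=
    (a.+1 * r) * (a.+1 * r) + 2 * (a * r * (d * r + L)) +
    (d * r * r + (q * h * h + s * s)) + 4 * (a * L) + 2 * r0 * (a * a.-1).
Proof.
move=> a2 hr sr rhh rhs dP aL nE.
have [y yinj yP] : exists2 y : 'I_a -> 'I_d * 'I_r0.+2, injective y &
    forall i j, i != j -> (y i).1 = (y j).1 -> 2 < r.
  case: dP => [[-> [ar r2]]|->].
    by exists (fun i => (ord0, widen_ord ar i)) => // i j [] /val_inj.
  exists (fun i => (i, ord0)) => [i j [] //|i j ij /= e].
  by rewrite e eqxx in ij.
have aL' : a <= #|{: 'I_q * 'I_h + 'I_s}| by rewrite card_sum card_prod !card_ord.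
pose z (i : 'I_a) := enum_val (widen_ord aL' i).
have zinj : injective z by move=> i j /enum_val_inj e; apply: val_inj; exact: (congr1 val e).
have [G [coG eG]] := blocks_on_ordinals yinj zinj a2 hr sr rhh rhs yP nE.
exists G; split=> //.
have := blocks_edges_le y zinj erefl erefl erefl.
rewrite -/r -/L => le.
apply: leq_trans le; move: nE eG; rewrite -/r; move: #|edges G| => e.
move: (2 * r * (a * L)) (a.+1 * r) (d * r + L) => x1 x2 x3; lia.
Qed.

(** Setting [k - h] vertices aside before dividing by [h] keeps the last block large: it gets them
    together with the remainder. *)
Lemma block_sizes (k h L : nat) :
    0 < h -> h <= k -> k <= h + h -> k <= L + h ->
  exists q s, [/\ L = q * h + s, s < k & k <= h + s].
Proof.
move=> h0 hk khh kL; exists ((L - (k - h)) %/ h), ((L - (k - h)) %% h + (k - h)).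
have := divn_eq (L - (k - h)) h; have := ltn_pmod (L - (k - h)) h0.
move: (_ %% h) (_ %/ h * h) => x1 x2; split; lia.
Qed.

Local Open Scope ring_scope.

Theorem theorem1p7 (t k n : nat) (ht : t = 4%N \/ t = 5%N) (hk : (3 <= k)%N)
  (hn : ((2 * t - 3) * (k - 1) + uphalf k * uphalf k - 1 <= n)%N) :
  exists G : sgraph 'I_n,
    co_critical G t k /\
    (#|edges G|%:R : rat) <=
      ((4 * t%:R - 9) / 2 + 1 / 2 * (uphalf k)%:R) * n%:R + Ctk t k.
Proof.
have [a ta a23] : exists2 a, t = a.+2 & a = 2%N \/ a = 3%N.
  by case: ht => ->; [exists 2%N | exists 3%N]; auto.
have [r0 kr] : exists r0, k = r0.+3 by exists (k - 3)%N; lia.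
set h := uphalf k in hn *.
have hE : (k = h + h \/ k.+1 = h + h)%N.
  by have := odd_double_half k.+1; rewrite -/h -addnn; case: odd; lia.
(* For [k >= 4] one heavy clique holds all the [y_i]; for [k = 3] a clique with two of
   them would not be forced to be monochromatic. *)
have [d [dE dP]] : exists d, (k = 3%N /\ d = a \/ (3 < k)%N /\ d = 1%N) /\
    ((d = 1 /\ a <= r0.+2 /\ 2 < r0.+2)%N \/ d = a).
  by have [k3|k3] := ltnP 3 k; [exists 1%N | exists a]; lia.
pose L := (n - (a.+1 * r0.+2 + d * r0.+2))%N.
have h2 : (1 < h)%N by lia.
have hh : (h * 2 <= h * h)%N by rewrite leq_mul2l h2 orbT.
(* For [k = 3] the hub and the [a] heavy cliques take exactly [(2 * t - 3) * (k - 1)] vertices, and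
   [h * h - 1 = 3] leaves room for the [z i]. *)
have [nL aL kL] : [/\ n = a.+1 * r0.+2 + (d * r0.+2 + L), a <= L & k <= L + h]%N.
  rewrite /L; move: (h * h)%N hn hh => hh' hn hh; subst t k.
  by case: a23 dE => aE [[kE dE]|[kE dE]]; subst a d; split; lia.
have [||||q [s [Ls sk ks]]] := @block_sizes k h L.
- exact: ltnW.
- by clear -hE hk; lia.
- by clear -hE; lia.
- exact: kL.
have := @exists_co_critical a r0 d q h s n; rewrite -Ls => ex.
have [|||||G [coG eG]] := ex _ _ _ _ _ dP aL nL.
- by case: a23 => ->.
- by clear -hE kr hk; lia.
- by clear -sk kr; lia.
- by clear -hE kr hk; lia.
- by clear -ks kr; lia.
clear ex.
exists G; split; first by rewrite ta kr.
have {}eG : (#|edges G|%:R * 2 + n%:R + 2 * a%:R + 2 * r0.+2%:R * (a%:R * L%:R) <=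
    (a%:R + 1) * r0.+2%:R * ((a%:R + 1) * r0.+2%:R) +
    2 * (a%:R * r0.+2%:R * (d%:R * r0.+2%:R + L%:R)) +
    (d%:R * r0.+2%:R * r0.+2%:R + (q%:R * h%:R * h%:R + s%:R * s%:R)) +
    4 * (a%:R * L%:R) + 2 * r0%:R * (a%:R * (a%:R - 1)) :> rat).
  have -> : a%:R - 1 = a.-1%:R :> rat by case: a23 => ->.
  by move: eG; rewrite -(Num.Theory.ler_nat rat) !(GRing.natrD, GRing.natrM) -[a.+1]addn1 GRing.natrD.
rewrite /Ctk; have kR : k%:R = r0%:R + 3 :> rat by rewrite kr -[r0.+3]addn3 GRing.natrD.
have rR : r0.+2%:R = r0%:R + 2 :> rat by rewrite -[r0.+2]addn2 GRing.natrD.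
have tR : t%:R = a%:R + 2 :> rat by rewrite ta -[a.+2]addn2 GRing.natrD.
have nR : n%:R = (a%:R + 1) * r0.+2%:R + (d%:R * r0.+2%:R + L%:R) :> rat.
  by rewrite [in LHS]nL !(GRing.natrD, GRing.natrM) -[a.+1]addn1 GRing.natrD.
have LR : L%:R = q%:R * h%:R + s%:R :> rat by rewrite Ls GRing.natrD GRing.natrM.
have h2R : 2 <= h%:R :> rat by rewrite (Num.Theory.ler_nat rat 2).
(* Expanded, this is [s^2 <= h * s + (k - 1) * (k - 1 - h)]: the squared sizes of the light cliques
   sum to at most [h * L] plus a term free of [n]. *)
have sR : (k%:R - 1 - s%:R) * (k%:R - 1 + s%:R - h%:R) >= 0 :> rat.
  rewrite (_ : k%:R - 1 = (k - 1)%:R); last by rewrite GRing.natrB // ltnW // ltnW.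
  rewrite Num.Theory.mulr_ge0 //.
    by rewrite Num.Theory.subr_ge0 Num.Theory.ler_nat; clear -sk hk; lia.
  by rewrite -GRing.natrD Num.Theory.subr_ge0 Num.Theory.ler_nat; clear -sk ks hE hk; lia.
have kh : k%:R = h%:R + h%:R :> rat \/ k%:R + 1 = h%:R + h%:R :> rat.
  by case: hE => e; [left|right]; rewrite -GRing.natrD -?e // -[k.+1]addn1 GRing.natrD.
have kd : k%:R = 3 :> rat /\ h%:R = 2 :> rat /\ d%:R = a%:R :> rat \/ d%:R = 1 :> rat.
  case: dE => -[k3 ->]; [left | by right]; split; first by rewrite k3.
  by split=> //; rewrite (_ : h = 2%N) //; clear -hE k3; lia.
(* In the bound on twice the edges, [2 * r * a * L] cancels and [L] keeps the factor
   [4 * a + h - 1 = 4 * t - 9 + h], twice the claimed slope. Only constants remain to be compared,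
   for each parity of [k]. *)
rewrite -/h tR; move: eG; rewrite !nR !LR !rR; move: kR sR h2R kh kd.
move: (k%:R) (r0%:R) (h%:R) (q%:R) (s%:R) (#|edges G|%:R) (d%:R) => k' r' h' q' s' E d'.
move=> kR; have -> : r' = k' - 3 by rewrite kR GRing.addrK.
move=> sR h2R.
case: a23 => -> kh [[k3 [hh2 ->]]|->].
- rewrite k3 hh2 in sR *; lra.
- case: kh => [kE|kE].
    rewrite kE in sR *; nra.
  have {}kE : k' = h' + h' - 1 by rewrite -kE GRing.addrK.
  rewrite kE in sR *; nra.
- rewrite k3 hh2 in sR *; lra.
- case: kh => [kE|kE].
    rewrite kE in sR *; nra.
  have {}kE : k' = h' + h' - 1 by rewrite -kE GRing.addrK.
  rewrite kE in sR *; nra.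
Qed.
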